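(* In a one-parameter planar homothetic hyperbolic motion $\mathbb{H}/\mathbb{H}'$, given by $\mathbf{x}'=(h\mathbf{x}-\mathbf{u})e^{j\varphi}$, with $\dot h^2-h^2\dot\varphi^2\neq0$ for all $t$, let $X$ be a moving point represented in $\mathbb{H}$ by a $C^\infty$ function $\mathbf{x}=\mathbf{x}(t)$. Then the absolute acceleration $\mathbf{b}_a$, the sliding acceleration $\mathbf{b}_f$, the Coriolis acceleration $\mathbf{b}_c$ and the relative acceleration $\mathbf{b}_r$ of $X$ satisfy $$\mathbf{b}_a=\mathbf{b}_f+\mathbf{b}_c+\mathbf{b}_r .$$
   Context: Hyperbolic numbers: $\mathbb{R}[j]=\{x+jy: x,y\in\mathbb{R}\}$ with $j^2=1$ ($j\neq\pm1$), a commutative ring; $e^{j\varphi}=\cosh\varphi+j\sinh\varphi$ for $\varphi\in\mathbb{R}$. A hyperbolic number $x+jy$ is invertible iff $x^2\ne y^2$. One-parameter planar homothetic hyperbolic motion $\mathbb{H}/\mathbb{H}'$: $\mathbb{H}$ (moving) and $\mathbb{H}'$ (fixed) are two copies of the plane of hyperbolic numbers. Let $t$ range over a real interval containing $0$, and let $h,\varphi$ (real valued) and $\mathbf{u}=u_1+ju_2$ (hyperbolic-number valued) be $C^\infty$ functions of $t$, with $h$ (the homothetic scale) non-constant, $\dot\varphi(t)\neq0$ for all $t$, and the two coordinate systems coincident at $t=0$. A point represented in $\mathbb{H}$ by $\mathbf{x}$ is represented in $\mathbb{H}'$ at time $t$ by $\mathbf{x}'=(h\mathbf{x}-\mathbf{u})e^{j\varphi}$.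 Dots denote $d/dt$. The pole point in $\mathbb{H}$ is $\mathbf{p}=\dfrac{\dot{\mathbf{u}}+j\dot\varphi\mathbf{u}}{\dot h+jh\dot\varphi}$. Absolute velocity of $X$ (its velocity with respect to $\mathbb{H}'$): $\mathbf{V}_a=\frac{d\mathbf{x}'}{dt}=(\dot h+jh\dot\varphi)\mathbf{x}e^{j\varphi}-(\dot{\mathbf{u}}+j\mathbf{u}\dot\varphi)e^{j\varphi}+h\dot{\mathbf{x}}e^{j\varphi}$. Accelerations: - absolute: $\mathbf{b}_a=\dot{\mathbf{V}}_a$; - relative (with respect to $\mathbb{H}'$): $\mathbf{b}_r=h\ddot{\mathbf{x}}e^{j\varphi}$; - sliding: $\mathbf{b}_f=(\mathbf{x}-\mathbf{p})\left[\ddot h+h\dot\varphi^2+j(2\dot h\dot\varphi+h\ddot\varphi)\right]e^{j\varphi}-\dot{\mathbf{p}}(\dot h+jh\dot\varphi)e^{j\varphi}$; - Coriolis: $\mathbf{b}_c=2\dot{\mathbf{x}}(\dot h+jh\dot\varphi)e^{j\varphi}$. *)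

(* Defs.v *)
From HB Require Import structures.
From mathcomp Require Import all_boot all_order all_algebra.
From mathcomp Require Import ring.
From mathcomp Require Import all_classical all_reals all_analysis.

Set Implicit Arguments.
Unset Strict Implicit.
Unset Printing Implicit Defensive.

Import Order.TTheory GRing.Theory Num.Theory.
Import numFieldNormedType.Exports.

Local Open Scope classical_set_scope.
Local Open Scope ring_scope.

(* In ring_scope these notations denote derivatives of polynomials. *)
Local Notation "f ^` ()" := (derive1 f) : ring_scope.
Local Notation "f ^` ( n )" := (derive1n n f) : ring_scope.

(* Hyp x y is the hyperbolic number x + j y.  A record rather than an alias of
   R * R, which already carries the componentwise product as its ring product. *)
Record hyp (R : realType) : Type := Hyp { hre : R ; him : R }.

Section HypModule.
Variable R : realType.
Implicit Types a b c : hyp R.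

Definition hyp_pair a : R * R := (hre a, him a).
Definition pair_hyp (p : R * R) : hyp R := Hyp p.1 p.2.

Lemma hyp_pairK : cancel hyp_pair pair_hyp.
Proof. by case. Qed.

HB.instance Definition _ := Choice.copy (hyp R) (can_type hyp_pairK).

Definition hyp_zero : hyp R := Hyp 0 0.
Definition hyp_opp a : hyp R := Hyp (- hre a) (- him a).
Definition hyp_add a b : hyp R := Hyp (hre a + hre b) (him a + him b).
Definition hyp_scale (k : R) a : hyp R := Hyp (k * hre a) (k * him a).

Lemma hyp_addA : associative hyp_add.
Proof. by move=> [a1 a2] [b1 b2] [c1 c2]; congr Hyp => /=; ring. Qed.

Lemma hyp_addC : commutative hyp_add.
Proof. by move=> [a1 a2] [b1 b2]; congr Hyp => /=; ring. Qed.

Lemma hyp_add0 : left_id hyp_zero hyp_add.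
Proof. by move=> [a1 a2]; congr Hyp => /=; ring. Qed.

Lemma hyp_addN : left_inverse hyp_zero hyp_opp hyp_add.
Proof. by move=> [a1 a2]; congr Hyp => /=; ring. Qed.

HB.instance Definition _ := GRing.isZmodule.Build (hyp R)
  hyp_addA hyp_addC hyp_add0 hyp_addN.

Lemma hyp_scaleA k l a : hyp_scale k (hyp_scale l a) = hyp_scale (k * l) a.
Proof. by case: a => [a1 a2]; congr Hyp => /=; ring. Qed.

Lemma hyp_scale1 : left_id 1 hyp_scale.
Proof. by move=> [a1 a2]; congr Hyp => /=; ring. Qed.

Lemma hyp_scaleDr : right_distributive hyp_scale +%R.
Proof. by move=> k [a1 a2] [b1 b2]; congr Hyp => /=; ring. Qed.

Lemma hyp_scaleDl a : {morph hyp_scale^~ a : k l / k + l}.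
Proof. by case: a => [a1 a2] k l; congr Hyp => /=; ring. Qed.

HB.instance Definition _ := GRing.Zmodule_isLmodule.Build R (hyp R)
  hyp_scaleA hyp_scale1 hyp_scaleDr hyp_scaleDl.

(* Any norm would do: it only serves to give hyp R the topology of R * R. *)
Definition hyp_norm a : R := Num.max `|hre a| `|him a|.

Lemma hyp_normD a b : hyp_norm (a + b) <= hyp_norm a + hyp_norm b.
Proof.
by rewrite /hyp_norm ge_max !(le_trans (ler_normD _ _)) // lerD // le_max lexx
  ?orbT.
Qed.

Lemma hyp_normZ k a : hyp_norm (k *: a) = `|k| * hyp_norm a.
Proof. by rewrite /hyp_norm /= !normrM maxr_pMr. Qed.

Lemma hyp_norm0_eq0 a : hyp_norm a = 0 -> a = 0.
Proof.
case: a => [a1 a2] a0.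
have : hyp_norm (Hyp a1 a2) <= 0 by rewrite a0.
by rewrite ge_max !normr_le0 /= => /andP[/eqP -> /eqP ->].
Qed.

HB.instance Definition _ := Lmodule_isNormed.Build R (hyp R)
  hyp_normD hyp_normZ hyp_norm0_eq0.

End HypModule.

Section HypRing.
Variable R : realType.
Implicit Types a b c : hyp R.

Definition hyp_one : hyp R := Hyp 1 0.

Definition hyp_mul a b : hyp R :=
  Hyp (hre a * hre b + him a * him b) (hre a * him b + him a * hre b).

Definition hyp_unit : pred (hyp R) := fun a => hre a ^+ 2 != him a ^+ 2.

(* As everywhere in the library, non-units are their own inverse. *)
Definition hyp_inv a : hyp R :=
  if hyp_unit a then
    Hyp (hre a / (hre a ^+ 2 - him a ^+ 2)) (- him a / (hre a ^+ 2 - him a ^+ 2))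
  else a.

Lemma hyp_mulA : associative hyp_mul.
Proof. by move=> [a1 a2] [b1 b2] [c1 c2]; congr Hyp => /=; ring. Qed.

Lemma hyp_mulC : commutative hyp_mul.
Proof. by move=> [a1 a2] [b1 b2]; congr Hyp => /=; ring. Qed.

Lemma hyp_mul1 : left_id hyp_one hyp_mul.
Proof. by move=> [a1 a2]; congr Hyp => /=; ring. Qed.

Lemma hyp_mulDl : left_distributive hyp_mul +%R.
Proof. by move=> [a1 a2] [b1 b2] [c1 c2]; congr Hyp => /=; ring. Qed.

Lemma hyp_one_neq0 : hyp_one != 0.
Proof. by apply/eqP => -[/eqP]; rewrite oner_eq0. Qed.

HB.instance Definition _ := GRing.Zmodule_isComNzRing.Build (hyp R)
  hyp_mulA hyp_mulC hyp_mul1 hyp_mulDl hyp_one_neq0.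

Lemma hyp_scaleAl (k : R) a b : k *: (a * b) = (k *: a) * b.
Proof. by case: a b => [a1 a2] [b1 b2]; congr Hyp => /=; ring. Qed.

HB.instance Definition _ :=
  GRing.Lmodule_isLalgebra.Build R (hyp R) hyp_scaleAl.
HB.instance Definition _ := GRing.Lalgebra_isComAlgebra.Build R (hyp R).

Lemma hyp_mulVr : {in hyp_unit, left_inverse 1 hyp_inv *%R}.
Proof.
move=> [a1 a2] a_unit; rewrite /hyp_inv (a_unit : hyp_unit _).
have d_neq0 : a1 ^+ 2 - a2 ^+ 2 != 0 by rewrite subr_eq0.
by congr Hyp => /=; field.
Qed.

Lemma hyp_unitP a b : b * a = 1 -> hyp_unit a.
Proof.
case: a b => [a1 a2] [b1 b2] [/= e1 e2]; apply/eqP => /= e.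
have : (b1 * a1 + b2 * a2) ^+ 2 - (b1 * a2 + b2 * a1) ^+ 2
     = (b1 ^+ 2 - b2 ^+ 2) * (a1 ^+ 2 - a2 ^+ 2) by ring.
by rewrite e1 e2 e subrr mulr0 expr0n expr1n subr0 => /eqP; rewrite oner_eq0.
Qed.

Lemma hyp_inv_out : {in [predC hyp_unit], hyp_inv =1 id}.
Proof. by move=> a a_nunit; rewrite /hyp_inv (negbTE (a_nunit : ~~ hyp_unit a)). Qed.

HB.instance Definition _ := GRing.ComNzRing_hasMulInverse.Build (hyp R)
  hyp_mulVr hyp_unitP hyp_inv_out.

End HypRing.

Definition hj (R : realType) : hyp R := Hyp 0 1.

Definition cosh (R : realType) (a : R) : R := (expR a + expR (- a)) / 2.
Definition sinh (R : realType) (a : R) : R := (expR a - expR (- a)) / 2.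

Definition expj (R : realType) (a : R) : hyp R :=
  (cosh a)%:A + hj R * (sinh a)%:A.

(* Smoothness on a set that need not be open: f is infinitely differentiable on
   a neighbourhood of every point of A, so that at the end points of an interval
   the two-sided derivatives of f used below are the usual one-sided ones. *)
Definition smooth_on (R : realType) (V : normedModType R) (A : set R)
    (f : R -> V) : Prop :=
  forall t, A t -> \forall s \near t, forall n, derivable (f^`(n)) s 1.

Definition to_fixed (R : realType) (h phi : R -> R) (u x : R -> hyp R)
    (t : R) : hyp R :=
  (h t *: x t - u t) * expj (phi t).

(* Coincidence of the coordinate systems at time 0 means that the origins
   (u 0 = 0) and the axes (phi 0 = 0) coincide; h 0 is left free. *)
Record homothetic_motion (R : realType) (I : interval R) (h phi : R -> R)
    (u : R -> hyp R) : Prop := HomotheticMotion {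
  motion_interval : 0 \in I ;
  motion_smooth_h : smooth_on [set` I] h ;
  motion_smooth_phi : smooth_on [set` I] phi ;
  motion_smooth_u : smooth_on [set` I] u ;
  motion_h_nonconstant : ~ exists c, forall t, t \in I -> h t = c ;
  motion_dphi_neq0 : forall t, t \in I -> phi^`() t != 0 ;
  motion_u0 : u 0 = 0 ;
  motion_phi0 : phi 0 = 0 }.

Section Kinematics.
Variables (R : realType) (h phi : R -> R) (u x : R -> hyp R).

Local Notation j := (hj R).

Definition pole_factor (t : R) : hyp R :=
  (h^`() t)%:A + j * (h t * phi^`() t)%:A.

Definition pole (t : R) : hyp R :=
  (u^`() t + j * (phi^`() t *: u t)) / pole_factor t.

Definition absolute_velocity : R -> hyp R := (to_fixed h phi u x)^`().

Definition absolute_acceleration : R -> hyp R := absolute_velocity^`().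

Definition relative_acceleration (t : R) : hyp R :=
  h t *: x^`(2) t * expj (phi t).

Definition sliding_acceleration (t : R) : hyp R :=
  (x t - pole t)
    * ((h^`(2) t + h t * phi^`() t ^+ 2)%:A
       + j * (2 * h^`() t * phi^`() t + h t * phi^`(2) t)%:A)
    * expj (phi t)
  - pole^`() t * pole_factor t * expj (phi t).

Definition coriolis_acceleration (t : R) : hyp R :=
  2 * x^`() t * pole_factor t * expj (phi t).

End Kinematics.

(* Main.v *)
(* Primes denote d/dt.  Write q for the pole factor and p for the pole, so that
   q p is the numerator of p and V_a = (q (x - p) + h x') e^{j phi} near any t
   of the interval: q is a unit on a neighbourhood of t, since being a unit is
   an open condition.  Differentiating this product gives the decomposition,
   because q' + j phi' q is the bracket in the sliding acceleration and
   q + h' + j h phi' = 2 q. *)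

Require Import Defs.
From mathcomp Require Import all_boot all_order all_algebra.
From mathcomp Require Import ring.
From mathcomp Require Import all_classical all_reals all_analysis.

Set Implicit Arguments.
Unset Strict Implicit.
Unset Printing Implicit Defensive.

Import Order.TTheory GRing.Theory Num.Theory.
Import numFieldNormedType.Exports.

Local Open Scope classical_set_scope.
Local Open Scope ring_scope.

(** The norm is the maximum of the absolute values of the coordinates: it dominates each of them,
    and it is below [e] as soon as both are. *)
Lemma cvg_hypP (R : realType) (T : Type) (F : set_system T) (FF : Filter F)
    (f : T -> hyp R) (a : hyp R) :
  f @ F --> a <-> (hre (f s) @[s --> F] --> hre a) /\
                  (him (f s) @[s --> F] --> him a).
Proof.
split=> [fa|[/cvgrPdist_lt fre /cvgrPdist_lt fim]].
  split; apply/cvgrPdist_lt => e e_gt0; move/cvgrPdist_lt: fa => /(_ _ e_gt0);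
    apply: filterS => s /=; apply: le_lt_trans.
    by rewrite [leRHS]/Num.norm /= /hyp_norm le_max lexx.
  by rewrite [leRHS]/Num.norm /= /hyp_norm le_max lexx orbT.
apply/cvgrPdist_lt => e e_gt0.
move: (fre _ e_gt0) (fim _ e_gt0); apply: filterS2 => s re_lt im_lt.
by rewrite /Num.norm /= /hyp_norm gt_max re_lt.
Qed.

(** Exposes the limit of the difference quotient, so that [cvg_hypP] can split derivatives into
    coordinates. *)
Lemma is_deriveP (R : numFieldType) (V W : normedModType R) (f : V -> W)
    (a v : V) (d : W) :
  is_derive a v f d <-> h^-1 *: (f (h *: v + a) - f a) @[h --> 0^'] --> d.
Proof.
split=> [[fa <-]|fd]; first exact: fa.
by split; [apply/cvg_ex; exists d | apply/cvg_lim].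
Qed.

Lemma is_derive_hypP (R : realType) (V : normedModType R) (f : V -> hyp R)
    (a v : V) (d : hyp R) :
  is_derive a v f d <->
  is_derive a v (fun s => hre (f s)) (hre d) /\
  is_derive a v (fun s => him (f s)) (him d).
Proof. by rewrite !is_deriveP cvg_hypP. Qed.

Lemma is_derive_hypM (R : realType) (V : normedModType R) (f g : V -> hyp R)
    (a v : V) (df dg : hyp R) :
  is_derive a v f df -> is_derive a v g dg ->
  is_derive a v (fun s => f s * g s) (f a * dg + g a * df).
Proof.
move=> /is_derive_hypP[fr fi] /is_derive_hypP[gr gi]; apply/is_derive_hypP.
split.
  apply: (is_derive_eq (is_deriveD (is_deriveM fr gr) (is_deriveM fi gi))).
  by rewrite /GRing.scale /=; ring.
apply: (is_derive_eq (is_deriveD (is_deriveM fr gi) (is_deriveM fi gr))).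
by rewrite /GRing.scale /=; ring.
Qed.

Lemma is_derive_hypZ (R : realType) (V : normedModType R) (k : V -> R)
    (f : V -> hyp R) (a v : V) (dk : R) (df : hyp R) :
  is_derive a v k dk -> is_derive a v f df ->
  is_derive a v (fun s => k s *: f s) (k a *: df + dk *: f a).
Proof.
move=> dka /is_derive_hypP[fr fi]; apply/is_derive_hypP.
split.
  apply: (is_derive_eq (is_deriveM dka fr)).
  by rewrite /GRing.scale /=; ring.
apply: (is_derive_eq (is_deriveM dka fi)).
by rewrite /GRing.scale /=; ring.
Qed.

(** Units are the points where the quadratic form [N] does not vanish, and [N] is continuous along
    [f]. *)
Lemma near_hyp_unit (R : realType) (f : R -> hyp R) (t : R) :
  derivable f t 1 -> f t \is a GRing.unit ->
  \forall s \near t, f s \is a GRing.unit.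
Proof.
move=> /derivableP /is_derive_hypP[fr fi] ft_unit.
pose N s := hre (f s) * hre (f s) - him (f s) * him (f s).
have dN : is_derive t 1 N _ := is_deriveB (is_deriveM fr fr) (is_deriveM fi fi).
have /derivable1_diffP/differentiable_continuous Nc :=
  @ex_derive _ _ _ _ _ _ _ dN.
have Nt : N t != 0 by move: ft_unit; rewrite /N subr_eq0.
by apply: filterS (cvgr_neq0 _ Nc Nt) => s; rewrite /N subr_eq0.
Qed.

Lemma derivable_hypV (R : realType) (f : R -> hyp R) (t : R) :
  derivable f t 1 -> f t \is a GRing.unit -> derivable (fun s => (f s)^-1) t 1.
Proof.
move=> df ft_unit; have /derivableP /is_derive_hypP[fr fi] := df.
pose N s := hre (f s) * hre (f s) - him (f s) * him (f s).
have dN := is_deriveB (is_deriveM fr fr) (is_deriveM fi fi).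
have Nt : N t != 0 by move: ft_unit; rewrite /N subr_eq0.
have dNV := is_deriveV Nt dN.
pose g s := Hyp (hre (f s) * (N s)^-1) (- him (f s) * (N s)^-1).
(* The inverse is the conjugate divided by [N] on units only, so [g] replaces it on a neighbourhood
   of [t] where [f] stays a unit. *)
apply: (@near_eq_derivable _ _ _ g).
  near=> s; have fs_unit : f s \is a GRing.unit.
    by near: s; exact: near_hyp_unit.
  by rewrite /g [RHS]/GRing.inv /= /hyp_inv (fs_unit : hyp_unit _) !expr2.
have dg : is_derive t 1 g (Hyp _ _) := (@is_derive_hypP _ _ g t 1 (Hyp _ _)).2
  (conj (is_deriveM fr dNV) (is_deriveM (is_deriveN fi) dNV)).
exact: (@ex_derive _ _ _ _ _ _ _ dg).
Unshelve. all: by end_near. Qed.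

Lemma hyp_algE (R : realType) (k l : R) : k%:A + hj R * l%:A = Hyp k l.
Proof. by congr Hyp; rewrite /= /GRing.scale /=; ring. Qed.

Lemma is_derive_expRN (R : realType) (a : R) :
  is_derive a 1 (fun s => expR (- s)) (- expR (- a)).
Proof.
apply: (is_derive_eq (is_derive1_comp (is_derive_expR (- a)) (is_deriveNid a 1))).
by rewrite mulrN1.
Qed.

Lemma is_derive_cosh (R : realType) (a : R) : is_derive a 1 (@cosh R) (sinh a).
Proof.
have -> : @cosh R = (fun s => 2^-1 *: (expR s + expR (- s))).
  by apply/funext => s; rewrite /cosh mulrC.
apply: (is_derive_eq
  (is_deriveZ 2^-1 (is_deriveD (is_derive_expR a) (is_derive_expRN a)))).
by rewrite [LHS]mulrC.
Qed.

Lemma is_derive_sinh (R : realType) (a : R) : is_derive a 1 (@sinh R) (cosh a).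
Proof.
have -> : @sinh R = (fun s => 2^-1 *: (expR s - expR (- s))).
  by apply/funext => s; rewrite /sinh mulrC.
apply: (is_derive_eq
  (is_deriveZ 2^-1 (is_deriveB (is_derive_expR a) (is_derive_expRN a)))).
by rewrite opprK [LHS]mulrC.
Qed.

(** Differentiation exchanges [cosh] and [sinh], and multiplication by [hj R] exchanges the two
    coordinates. *)
Lemma is_derive_expj_comp (R : realType) (phi : R -> R) (t dphi : R) :
  is_derive t 1 phi dphi ->
  is_derive t 1 (fun s => expj (phi s)) (hj R * dphi%:A * expj (phi t)).
Proof.
move=> dp; apply/is_derive_hypP.
have -> : (fun s => hre (expj (phi s))) = (@cosh R) \o phi.
  by apply/funext => s; rewrite /expj hyp_algE.
have -> : (fun s => him (expj (phi s))) = (@sinh R) \o phi.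
  by apply/funext => s; rewrite /expj hyp_algE.
split.
  apply: (is_derive_eq (is_derive1_comp (is_derive_cosh (phi t)) dp)).
  by rewrite /expj hyp_algE /= /GRing.scale /=; ring.
apply: (is_derive_eq (is_derive1_comp (is_derive_sinh (phi t)) dp)).
by rewrite /expj hyp_algE /= /GRing.scale /=; ring.
Qed.

Lemma is_derive_hyp_alg (R : realType) (k : R -> R) (t dk : R) :
  is_derive t 1 k dk -> is_derive t 1 (fun s => (k s)%:A : hyp R) dk%:A.
Proof.
move=> kt; have := is_derive_hypZ kt (is_derive_cst (1 : hyp R) t 1).
by rewrite scaler0 add0r.
Qed.

Lemma is_derive_derive1 (R : numFieldType) (V : normedModType R) (f : R -> V)
    (t : R) (d : V) : is_derive t 1 f d -> derive1 f t = d.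
Proof. by move=> dt; rewrite derive1E derive_val. Qed.

Lemma is_derive1 (R : numFieldType) (V : normedModType R) (f : R -> V) (t : R) :
  derivable f t 1 -> is_derive t 1 f (derive1 f t).
Proof. by rewrite derive1E; exact: derivableP. Qed.

(** Equals [pole_factor] times [pole] wherever [pole_factor] is a unit. *)
Definition pole_numerator (R : realType) (phi : R -> R) (u : R -> hyp R)
    (t : R) : hyp R :=
  derive1 u t + hj R * (derive1 phi t *: u t).

(** Only one of the two h' phi' terms of the sliding bracket arises here; the other one, and h
    phi'^2, come from differentiating the exponential. *)
Lemma is_derive_pole_factor (R : realType) (h phi : R -> R) (t h2 phi2 : R) :
  is_derive t 1 h (derive1 h t) -> is_derive t 1 (derive1 h) h2 ->
  is_derive t 1 (derive1 phi) phi2 ->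
  is_derive t 1 (pole_factor h phi)
    (h2%:A + hj R * (derive1 h t * derive1 phi t + h t * phi2)%:A).
Proof.
move=> dh ddh ddphi.
have dhphi := is_derive_hyp_alg (is_deriveM dh ddphi).
apply: (is_derive_eq (is_deriveD (is_derive_hyp_alg ddh)
  (is_derive_hypM (is_derive_cst (hj R) t 1) dhphi))).
rewrite mulr0 addr0; congr (_ + hj R * _%:A).
by rewrite addrC [_ *: _]mulrC.
Qed.

Lemma derivable_pole_numerator (R : realType) (phi : R -> R) (u : R -> hyp R)
    (t : R) :
  derivable u t 1 -> derivable (derive1 u) t 1 -> derivable (derive1 phi) t 1 ->
  derivable (pole_numerator phi u) t 1.
Proof.
move=> /derivableP du /derivableP ddu /derivableP ddphi.
have dw := is_deriveD ddu
  (is_derive_hypM (is_derive_cst (hj R) t 1) (is_derive_hypZ ddphi du)).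
exact: (@ex_derive _ _ _ _ _ _ _ dw).
Qed.

(** In the product rule, the exponential contributes j phi' (h x - u); collecting the terms in x and
    those in u gives the factor and the numerator of the pole. *)
Lemma absolute_velocityE (R : realType) (h phi : R -> R) (u x : R -> hyp R)
    (t : R) :
  derivable h t 1 -> derivable phi t 1 -> derivable u t 1 -> derivable x t 1 ->
  absolute_velocity h phi u x t =
  (pole_factor h phi t * x t - pole_numerator phi u t + h t *: derive1 x t)
    * expj (phi t).
Proof.
move=> /derivableP dh /derivableP dphi /derivableP du /derivableP dx.
have dx' := is_derive_hypM (is_deriveB (is_derive_hypZ dh dx) du)
  (is_derive_expj_comp dphi).
rewrite /absolute_velocity (is_derive_derive1 dx') -!derive1E.
rewrite /pole_factor /pole_numerator !fctE.
(* Scalings become ring products with constants [k%:A], and [(h t * derive1 phi t)%:A] is split into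
   two such constants, which leaves an identity for [ring]. *)
rewrite -![_ *: x _]mulr_algl -![_ *: u _]mulr_algl.
rewrite -![_ *: derive1 x _]mulr_algl.
rewrite -scalerA -[_ *: _%:A]mulr_algl.
ring.
Qed.

Theorem theorem2 (R : realType) (I : interval R) (h phi : R -> R)
    (u x : R -> hyp R)
    (motion : homothetic_motion I h phi u)
    (regular : forall t, t \in I ->
       derive1 h t ^+ 2 - h t ^+ 2 * derive1 phi t ^+ 2 != 0)
    (smooth_x : smooth_on [set` I] x) :
  forall t, t \in I ->
    absolute_acceleration h phi u x t =
    sliding_acceleration h phi u x t
    + coriolis_acceleration h phi x t
    + relative_acceleration h phi x t.
Proof.
move=> t It; case: motion => _ sh sphi su _ _ _ _.
(* Smoothness is kept near [t], to apply [absolute_velocityE] at nearby points, and also specialised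
   to [t], to differentiate there. *)
have nh := sh _ It; have nphi := sphi _ It.
have nu := su _ It; have nx := smooth_x _ It.
have dh := nbhs_singleton nh; have dphi := nbhs_singleton nphi.
have du := nbhs_singleton nu; have dx := nbhs_singleton nx.
(* The regularity hypothesis is the unit criterion for h' + j h phi'. *)
have q_unit : pole_factor h phi t \is a GRing.unit.
  have := regular t It.
  by rewrite -exprMn subr_eq0 /pole_factor hyp_algE.
have h0 : is_derive t 1 h (derive1 h t) := is_derive1 (dh 0).
(* Index [n] of smoothness says that the [n]-th derivative is derivable, so index 1 yields the
   second derivative. *)
have h1 : is_derive t 1 (derive1 h) (derive1n 2 h t) := is_derive1 (dh 1).
have phi0 : is_derive t 1 phi (derive1 phi t) := is_derive1 (dphi 0).
have phi1 : is_derive t 1 (derive1 phi) (derive1n 2 phi t) := is_derive1 (dphi 1).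
have x0 : is_derive t 1 x (derive1 x t) := is_derive1 (dx 0).
have x1 : is_derive t 1 (derive1 x) (derive1n 2 x t) := is_derive1 (dx 1).
have dq := is_derive_pole_factor h0 h1 phi1.
have dp : derivable (pole h phi u) t 1.
  have dw := derivableP (derivable_pole_numerator (du 0) (du 1) (dphi 1)).
  have dqV := derivableP (derivable_hypV (@ex_derive _ _ _ _ _ _ _ dq) q_unit).
  exact: (@ex_derive _ _ _ _ _ _ _ (is_derive_hypM dw dqV)).
have Va : \forall s \near t,
    (pole_factor h phi s * (x s - pole h phi u s) + h s *: derive1 x s)
      * expj (phi s) = absolute_velocity h phi u x s.
  near=> s.
  have qs_unit : pole_factor h phi s \is a GRing.unit.
    by near: s; exact: near_hyp_unit (@ex_derive _ _ _ _ _ _ _ dq) q_unit.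
  rewrite absolute_velocityE; first by rewrite mulrBr [X in _ - X]mulrC divrK.
  - by near: s; apply: filterS nh => s /(_ 0).
  - by near: s; apply: filterS nphi => s /(_ 0).
  - by near: s; apply: filterS nu => s /(_ 0).
  - by near: s; apply: filterS nx => s /(_ 0).
have dVa := is_derive_hypM
  (is_deriveD (is_derive_hypM dq (is_deriveB x0 (is_derive1 dp)))
              (is_derive_hypZ h0 x1))
  (is_derive_expj_comp phi0).
rewrite /absolute_acceleration (is_derive_derive1 (near_eq_is_derive Va dVa)).
rewrite /sliding_acceleration /coriolis_acceleration /relative_acceleration.
rewrite !fctE.
rewrite /pole_factor !hyp_algE.
(* The pole, its derivative and the exponential are generalised to arbitrary hyperbolic numbers:
   what remains is a polynomial identity in each coordinate. *)
case: (x t) (derive1 x t) (derive1n 2 x t) => [a1 a2] [b1 b2] [c1 c2].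
case: (pole h phi u t) (derive1 (pole h phi u) t) => [p1 p2] [d1 d2].
case: (expj (phi t)) => [e1 e2].
by congr Hyp; rewrite /= /GRing.scale /=; ring.
Unshelve. all: by end_near. Qed.
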